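(* Let $m,d,e,t\in\mathbb Q$, and put $$\Lambda=\frac{d^3+m^3}{2}+4e^3-4t^3+4,\qquad \Gamma=d^3+m^3+8e^3-8t^3-4 .$$ For $H,A,B\in\mathbb Q$, if $$C=\frac{m(A+H)}2-B,\quad D=\frac{d(A+H)}2,\quad E=e(A+H),\quad T=t(A+H),$$ then $$H^3+A^3+B^3+C^3+D^3+E^3-T^3=\frac{A+H}{4}\,Q_{m,d,e,t}(H,A,B),$$ where $$Q_{m,d,e,t}(H,A,B)=\Lambda(A^2+H^2)+\Gamma AH-3m^2B(A+H)+6mB^2 .$$ Consequently every rational point $(H,A,B)$ on the conic $Q_{m,d,e,t}=0$ gives a six-cube identity $H^3+A^3+B^3+C^3+D^3+E^3=T^3$. *)

(* Defs.v *)
From mathcomp Require Import all_boot all_order all_algebra.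

Set Implicit Arguments.
Unset Strict Implicit.
Unset Printing Implicit Defensive.

Import Order.TTheory GRing.Theory Num.Theory.

Local Open Scope ring_scope.

Definition Lambda (m d e t : rat) : rat :=
  (d ^+ 3 + m ^+ 3) / 2 + 4 * e ^+ 3 - 4 * t ^+ 3 + 4.

Definition Gamma (m d e t : rat) : rat :=
  d ^+ 3 + m ^+ 3 + 8 * e ^+ 3 - 8 * t ^+ 3 - 4.

(* [conicQ] is homogeneous of degree 2 in [(H, A, B)]: a rational point of the
   projective conic [conicQ = 0] is given by any rational coordinate triple. *)
Definition conicQ (m d e t H A B : rat) : rat :=
  Lambda m d e t * (A ^+ 2 + H ^+ 2) + Gamma m d e t * (A * H)
  - 3 * m ^+ 2 * B * (A + H) + 6 * m * B ^+ 2.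

(* Main.v *)
Require Import Defs.
From mathcomp Require Import all_boot all_order all_algebra.
From mathcomp Require Import ring.

Set Implicit Arguments.
Unset Strict Implicit.
Unset Printing Implicit Defensive.

Import Order.TTheory GRing.Theory Num.Theory.

Local Open Scope ring_scope.

(** Write [S = A + H]. Each of the four blocks [H ^+ 3 + A ^+ 3],
    [B ^+ 3 + C ^+ 3], [D ^+ 3] and [E ^+ 3 - T ^+ 3] is divisible by [S]: the
    first two because [x + y] divides [x ^+ 3 + y ^+ 3] and [B + C = m * S / 2],
    the last two because [D], [E] and [T] are multiples of [S]. After taking out
    [S / 4], the blocks contribute [4 * (A ^+ 2 - A * H + H ^+ 2)],
    [6 * m * B ^+ 2 - 3 * m ^+ 2 * B * S + m ^+ 3 * S ^+ 2 / 2],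
    [d ^+ 3 * S ^+ 2 / 2] and [4 * (e ^+ 3 - t ^+ 3) * S ^+ 2]. Expanding
    [S ^+ 2 = (A ^+ 2 + H ^+ 2) + 2 * A * H] and collecting the coefficients of
    [A ^+ 2 + H ^+ 2] and of [A * H] produces [Lambda] and [Gamma]. On the conic
    the right-hand side vanishes, which is the six-cube identity. *)

Theorem proposition2p1 (m d e t H A B C D E T : rat)
    (hC : C = m * (A + H) / 2 - B)
    (hD : D = d * (A + H) / 2)
    (hE : E = e * (A + H))
    (hT : T = t * (A + H)) :
  H ^+ 3 + A ^+ 3 + B ^+ 3 + C ^+ 3 + D ^+ 3 + E ^+ 3 - T ^+ 3
    = (A + H) / 4 * conicQ m d e t H A B
  /\ (conicQ m d e t H A B = 0 ->
      H ^+ 3 + A ^+ 3 + B ^+ 3 + C ^+ 3 + D ^+ 3 + E ^+ 3 = T ^+ 3).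
Proof.
have identity : H ^+ 3 + A ^+ 3 + B ^+ 3 + C ^+ 3 + D ^+ 3 + E ^+ 3 - T ^+ 3
    = (A + H) / 4 * conicQ m d e t H A B.
  by rewrite hC hD hE hT /conicQ /Lambda /Gamma; field.
split=> // on_conic.
by apply/eqP; rewrite -subr_eq0 identity on_conic mulr0.
Qed.
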